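(* Let $\mathfrak{M}_E=(E,\mathrm{rk})$ be a matroid without loops, with $r=\mathrm{rk}(E)$ and $m=|E|$, and write its characteristic polynomial as \[ \chi(\mathfrak{M}_E;t)=a_0t^r-a_1t^{r-1}+a_2t^{r-2}+\cdots+(-1)^ra_r, \] with the convention $a_i=0$ for $i>r$. If $q,k\in\mathbb{Z}$ satisfy $0\le k\le q+r+1$, then \[ \binom{r+q}{k}\le \sum_{i=0}^{k}\binom{q}{k-i}a_{i}\le \binom{m+q}{k}. \] In particular, for $0\le k\le r$, \[ \binom{r-1}{k}\le (-1)^k\sum_{i=0}^{k}(-1)^ia_{i}\le \binom{m-1}{k} \] and \[ (-1)^k\sum_{i=0}^{k}\binom{r-i}{k-i}(-1)^ia_{i}\ge 0. \]
   Context: A matroid $\mathfrak{M}_E=(E,\mathrm{rk})$ is a finite list $E$ with a rank function $\mathrm{rk}:2^E\to\mathbb{Z}_{\ge0}$ such that $\mathrm{rk}(A)\le|A|$; $A\subseteq B$ implies $\mathrm{rk}(A)\le\mathrm{rk}(B)$; and $\mathrm{rk}(A\cup B)+\mathrm{rk}(A\cap B)\le\mathrm{rk}(A)+\mathrm{rk}(B)$. An element $v\in E$ is a loop if $\mathrm{rk}(\{v\})=0$. The characteristic polynomial is $\chi(\mathfrak{M}_E;t)=\sum_{A\subseteq E}(-1)^{|A|}t^{\mathrm{rk}(E)-\mathrm{rk}(A)}$. For $\alpha\in\mathbb{C}$ and $k\in\mathbb{Z}_{\ge0}$, $\binom{\alpha}{k}=\frac{1}{k!}\alpha(\alpha-1)\cdots(\alpha-k+1)$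 is the generalized binomial coefficient (so $\binom{\alpha}{0}=1$). *)

(* Defs.v *)
From HB Require Import structures.
From mathcomp Require Import all_boot all_order all_algebra.

Set Implicit Arguments.
Unset Strict Implicit.
Unset Printing Implicit Defensive.

Import Order.TTheory GRing.Theory Num.Theory.
Local Open Scope ring_scope.

(* The ground "list" is a finType of labels, so that parallel (repeated)
   elements are distinct labels. *)
Record matroid (E : finType) := Matroid {
  rk : {set E} -> nat;
  rk_le_card : forall A : {set E}, (rk A <= #|A|)%N;
  rk_mono : forall A B : {set E}, A \subset B -> (rk A <= rk B)%N;
  rk_submod : forall A B : {set E},
    (rk (A :|: B) + rk (A :&: B) <= rk A + rk B)%N
}.

Definition is_loop (E : finType) (M : matroid E) (v : E) : bool :=
  rk M [set v] == 0%N.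

(* The truncated subtraction in the exponent is exact, by rk_mono. *)
Definition char_poly_matroid (E : finType) (M : matroid E) : {poly int} :=
  \sum_(A : {set E}) (-1) ^+ #|A| *: 'X^(rk M [set: E] - rk M A).

Definition gbinom (R : numFieldType) (alpha : R) (k : nat) : R :=
  (k`!%:R)^-1 * \prod_(j < k) (alpha - j%:R).

(* Main.v *)
Require Import Defs.
From HB Require Import structures.
From mathcomp Require Import all_boot all_order all_algebra.
From mathcomp Require Import zify ring.

Set Implicit Arguments.
Unset Strict Implicit.
Unset Printing Implicit Defensive.

Import Order.TTheory GRing.Theory Num.Theory.
Local Open Scope ring_scope.

(* Put w_M(u) = sum_i a_i u^i = sum_A (-1)^|A| (-u)^(rk A). The middle sum is the
   coefficient of u^k in (1+u)^q w_M(u). For a nonloop e, splitting the subsets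
   according to whether they contain e gives w_M = w_(M\e) + u w_(M/e), and w
   vanishes as soon as there is a loop. Hence induction on |E|: if e is a coloop,
   then w_M = (1+u) w_(M\e), and (r, m, q) may be replaced by (r-1, m-1, q+1);
   otherwise both bounds follow from those for M\e and M/e by Pascal's rule, the
   condition k <= q+r+1 keeping the discarded binomials nonnegative. The two
   special cases are q = -1 and q = k-r-1, by reflection of the upper index. *)

(** * Generalized binomial coefficients *)

Lemma gbinom0 (R : numFieldType) (x : R) : gbinom x 0 = 1.
Proof. by rewrite /gbinom big_ord0 mulr1 invr1. Qed.

Lemma gbinomS (R : numFieldType) (x : R) k :
  gbinom x k.+1 = gbinom x k * (x - k%:R) / k.+1%:R.
Proof.
rewrite /gbinom big_ord_recr /= factS natrM invfM.
by rewrite !mulrA [LHS]mulrC; ring.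
Qed.

(** Pascal's rule: both sides equal [gbinom x k * (x + 1) / k.+1%:R]. *)
Lemma gbinomDS (R : numFieldType) (x : R) k :
  gbinom (x + 1) k.+1 = gbinom x k.+1 + gbinom x k.
Proof.
have -> : gbinom (x + 1) k.+1 = gbinom x k * (x + 1) / k.+1%:R.
  rewrite /gbinom big_ord_recl /= subr0 factS natrM invfM.
  under eq_bigr => i _ do rewrite /bump add1n -natr1 opprD addrA addrAC addrK.
  by ring.
have k1 : k.+1%:R != 0 :> R by rewrite pnatr_eq0.
by apply: (mulIf k1); rewrite gbinomS mulrDl !mulfVK // -natr1; ring.
Qed.

Lemma gbinomnn (R : numFieldType) k : gbinom (k%:R : R) k = 1.
Proof.
elim: k => [|k IHk]; first exact: gbinom0.
by rewrite -natr1 gbinomDS gbinomS subrr mulr0 mul0r add0r.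
Qed.

(** Each factor n - j has j <= k - 1 <= n. The boundary case k = n + 1 is included: there the last
    factor is 0, or the product is empty. *)
Lemma gbinom_ge0 (R : numFieldType) (n : int) k :
  k%:Z <= n + 1 -> 0 <= gbinom (n%:~R : R) k.
Proof.
move=> le_kn; rewrite /gbinom mulr_ge0 ?invr_ge0 ?ler0n //.
apply: prodr_ge0 => j _.
rewrite -[j%:R]/(j%:Z%:~R) -intrB ler0z.
by have := ltn_ord j; lia.
Qed.

(** Read backwards, the factors on the right are x + i, the negatives of - x - i. *)
Lemma gbinomN (R : numFieldType) (x : R) k :
  gbinom (- x) k = (-1) ^+ k * gbinom (x + k%:R - 1) k.
Proof.
rewrite /gbinom mulrCA; congr (_ * _).
rewrite [in RHS](reindex_inj rev_ord_inj) /= -[X in (-1) ^+ X]card_ord -prodrN.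
apply: eq_bigr => i _.
by rewrite subnS -subn1 !natrB ?subn_gt0 //; [ring | apply: ltnW].
Qed.

(** The coefficient of u^k in (1+u)^x times the generating series of [b]. *)
Definition binom_conv (R : numFieldType) (x : R) (b : nat -> R) (k : nat) : R :=
  \sum_(i < k.+1) gbinom x (k - i) * b i.

Lemma eq_binom_conv (R : numFieldType) (x : R) (b c : nat -> R) :
  b =1 c -> binom_conv x b =1 binom_conv x c.
Proof. by move=> bc k; apply: eq_bigr => i _; rewrite bc. Qed.

Lemma binom_conv0 (R : numFieldType) (x : R) b : binom_conv x b 0 = b 0%N.
Proof. by rewrite /binom_conv big_ord1 gbinom0 mul1r. Qed.

Lemma binom_convDS (R : numFieldType) (x : R) b k :
  binom_conv (x + 1) b k.+1 = binom_conv x b k.+1 + binom_conv x b k.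
Proof.
rewrite /binom_conv ![\sum_(i < k.+2) _]big_ord_recr /= subnn !gbinom0.
rewrite addrAC -big_split /=; congr (_ + _); apply: eq_bigr => i _.
by rewrite subSn -1?ltnS // gbinomDS mulrDl.
Qed.

(** * Contraction, and the rank gained by adding one element *)

Section Whitney.

Variable E : finType.
Implicit Types (M : matroid E) (A B G : {set E}) (e v : E).

Lemma contract_le_card M e A : (rk M (e |: A) - rk M [set e] <= #|A|)%N.
Proof.
by have := rk_submod M [set e] A; have := rk_le_card M A; lia.
Qed.

Lemma contract_mono M e A B : A \subset B ->
  (rk M (e |: A) - rk M [set e] <= rk M (e |: B) - rk M [set e])%N.
Proof. by move=> sAB; rewrite leq_sub2r // rk_mono // setUS. Qed.

Lemma contract_submod M e A B :
  ((rk M (e |: (A :|: B)) - rk M [set e]) + (rk M (e |: (A :&: B)) - rk M [set e])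
   <= (rk M (e |: A) - rk M [set e]) + (rk M (e |: B) - rk M [set e]))%N.
Proof.
have ge_e C : (rk M [set e] <= rk M (e |: C))%N by rewrite rk_mono ?subsetUl.
have := rk_submod M (e |: A) (e |: B); rewrite -setUUr -setUIr.
by move: (ge_e A) (ge_e B) (ge_e (A :|: B)) (ge_e (A :&: B)); lia.
Qed.

(* The truncated subtraction is exact, by rk_mono. Contraction keeps the ground
   type, so [e] becomes a loop. *)
Definition contract M e : matroid E :=
  Matroid (contract_le_card M e) (@contract_mono M e) (contract_submod M e).

Lemma rk0 M : rk M set0 = 0%N.
Proof. by have := rk_le_card M set0; rewrite cards0; lia. Qed.

Lemma rk_nonloop M e : ~~ is_loop M e -> rk M [set e] = 1%N.
Proof. by have := rk_le_card M [set e]; rewrite /is_loop cards1; lia. Qed.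

Lemma rk_contract M e A : ~~ is_loop M e -> (rk (contract M e) A).+1 = rk M (e |: A).
Proof.
move=> /rk_nonloop e1; have := rk_mono M (subsetUl [set e] A).
by rewrite /= e1; lia.
Qed.

Lemma rkU1_le M e A : (rk M (e |: A) <= (rk M A).+1)%N.
Proof.
by have := rk_submod M [set e] A; have := rk_le_card M [set e]; rewrite cards1; lia.
Qed.

(** By submodularity, the rank gained by adding [e] can only shrink as the set grows, and it never
    exceeds one. *)
Lemma rkU1_coloop M e G A : e \notin G -> A \subset G ->
  rk M (e |: G) = (rk M G).+1 -> rk M (e |: A) = (rk M A).+1.
Proof.
move=> eG sAG eGr; have := rk_submod M (e |: A) G.
rewrite -setUA (setUidPr sAG) setIUl (setIidPl sAG).
have /eqP -> : [set e] :&: G == set0 by rewrite setI_eq0 disjoints1.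
by rewrite set0U; have := rkU1_le M e A; lia.
Qed.

Lemma rkU1_loop M v A : is_loop M v -> rk M (v |: A) = rk M A.
Proof.
move=> /eqP v0; have := rk_submod M [set v] A.
by have := rk_mono M (subsetUr [set v] A); lia.
Qed.

(** * Whitney numbers under deletion and contraction *)

Lemma sum_subsetD1 (R : nmodType) (F : {set E} -> R) G e : e \in G ->
  \sum_(A : {set E} | A \subset G) F A =
  \sum_(A : {set E} | A \subset G :\ e) F A +
  \sum_(A : {set E} | A \subset G :\ e) F (e |: A).
Proof.
move=> eG; rewrite (bigID (fun A : {set E} => e \in A)) /= addrC; congr (_ + _).
  by apply: eq_bigl => A; rewrite subsetD1.
rewrite (reindex_onto (fun A => e |: A) (fun A => A :\ e)) /=; last first.
  by move=> A /andP[_ eA]; rewrite setD1K.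
apply: eq_bigl => A; rewrite setU11 andbT subUset sub1set eG /= subsetD1.
congr (_ && _); apply/eqP/idP => [<-|eA]; first by rewrite setD11.
by rewrite setU1K.
Qed.

(** Up to sign, the Whitney numbers of the first kind of the restriction to [G]. Deletion shrinks
    [G] and contraction changes [M], so the ground type stays fixed. *)
Definition whitney (R : pzRingType) M G (i : nat) : R :=
  \sum_(A : {set E} | A \subset G) (-1) ^+ (i + #|A|) * (rk M A == i)%:R.

Lemma whitney_set0 (R : pzRingType) M i : whitney R M set0 i = (i == 0%N)%:R.
Proof.
rewrite /whitney (big_pred1 set0) => [|A]; last by rewrite subset0.
by rewrite rk0 cards0 addn0; case: i => [|i]; rewrite ?mul1r ?mulr0.
Qed.

(** The sets [A] and [v |: A] have equal rank and opposite signs, so they cancel. *)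
Lemma whitney_loop (R : pzRingType) M G v i :
  v \in G -> is_loop M v -> whitney R M G i = 0.
Proof.
move=> vG vl; rewrite /whitney (sum_subsetD1 _ vG) -big_split /= big1 // => A.
rewrite subsetD1 => /andP[_ vA].
by rewrite cardsU1 vA rkU1_loop // addnCA exprS mulN1r mulNr subrr.
Qed.

Lemma whitney_delcon0 (R : pzRingType) M G e : e \in G -> ~~ is_loop M e ->
  whitney R M G 0 = whitney R M (G :\ e) 0.
Proof.
move=> eG el; rewrite /whitney (sum_subsetD1 _ eG) [X in _ + X]big1 ?addr0 // => A _.
by rewrite -rk_contract // mulr0.
Qed.

(** For the sets containing [e], removing [e] lowers both the size and the index by one, so the sign
    is unchanged. *)
Lemma whitney_delconS (R : pzRingType) M G e i : e \in G -> ~~ is_loop M e ->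
  whitney R M G i.+1 =
  whitney R M (G :\ e) i.+1 + whitney R (contract M e) (G :\ e) i.
Proof.
move=> eG el; rewrite /whitney (sum_subsetD1 _ eG); congr (_ + _).
apply: eq_bigr => A; rewrite subsetD1 => /andP[_ eA].
by rewrite cardsU1 eA -rk_contract // eqSS addSn addnCA !exprS !mulN1r opprK.
Qed.

Lemma whitney_contract_coloop (R : pzRingType) M G e i :
  ~~ is_loop M e -> e \notin G -> rk M (e |: G) = (rk M G).+1 ->
  whitney R (contract M e) G i = whitney R M G i.
Proof.
move=> el eG eGr; apply: eq_bigr => A sAG.
by rewrite -eqSS rk_contract // (rkU1_coloop eG sAG) // eqSS.
Qed.

(** * Deletion-contraction for the convolution, and the bounds by induction *)

Lemma binom_conv_delcon0 (R : numFieldType) (x : R) M G e :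
  e \in G -> ~~ is_loop M e ->
  binom_conv x (whitney R M G) 0 = binom_conv x (whitney R M (G :\ e)) 0.
Proof. by move=> eG el; rewrite !binom_conv0 (whitney_delcon0 R eG el). Qed.

Lemma binom_conv_delconS (R : numFieldType) (x : R) M G e k :
  e \in G -> ~~ is_loop M e ->
  binom_conv x (whitney R M G) k.+1 =
  binom_conv x (whitney R M (G :\ e)) k.+1 +
  binom_conv x (whitney R (contract M e) (G :\ e)) k.
Proof.
move=> eG el; rewrite /binom_conv !(big_ord_recl k.+1) /= (whitney_delcon0 R eG el).
rewrite -addrA -big_split /=; congr (_ + _); apply: eq_bigr => i _.
by rewrite /bump add1n subSS (whitney_delconS R i eG el) mulrDr.
Qed.

(** Contracting and deleting a coloop give the same Whitney numbers, so the recursion contributes a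
    factor 1+u, absorbed into (1+u)^x. *)
Lemma binom_conv_coloop (R : numFieldType) (x : R) M G e k :
  e \in G -> ~~ is_loop M e -> rk M G = (rk M (G :\ e)).+1 ->
  binom_conv x (whitney R M G) k = binom_conv (x + 1) (whitney R M (G :\ e)) k.
Proof.
move=> eG el eGr; case: k => [|k].
  by rewrite (binom_conv_delcon0 x eG el) !binom_conv0.
rewrite (binom_conv_delconS x k eG el) binom_convDS; congr (_ + _).
apply: eq_binom_conv => i; apply: whitney_contract_coloop => //.
  by rewrite setD11.
by rewrite setD1K.
Qed.

Lemma whitney_bounds (R : numFieldType) M G (q : int) k :
  {in G, forall v, ~~ is_loop M v} -> k%:Z <= q + (rk M G)%:Z + 1 ->
  gbinom ((q + (rk M G)%:Z)%:~R : R) k <= binom_conv q%:~R (whitney R M G) k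
  <= gbinom ((q + #|G|%:Z)%:~R : R) k.
Proof.
have intrD1 (j : int) : (j + 1)%:~R = j%:~R + 1 :> R by rewrite intrD.
elim: {G}_.+1 {-2}G (ltnSn #|G|) M q k => // n IHn G ltGn M q k Gl le_k.
have [->|[e eG]] := set_0Vmem G.
  rewrite rk0 cards0 addr0 /binom_conv big_ord_recl big1 /= => [|i _].
    by rewrite whitney_set0 subn0 mulr1 addr0 lexx.
  by rewrite whitney_set0 mulr0.
have el := Gl e eG.
have cG : #|G| = #|G :\ e|.+1 by rewrite (cardsD1 e) eG.
have Dl : {in G :\ e, forall v, ~~ is_loop M v} by move=> v /setD1P[_ /Gl].
have ltDn : (#|G :\ e| < n)%N by rewrite -cG in ltGn *; lia.
(* Deleting [e] either lowers the rank by one, and [e] is a coloop, or preserves it. *)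
have := rkU1_le M e (G :\ e); rewrite setD1K // leq_eqVlt ltnS => /orP[/eqP cl|rGD].
  rewrite (binom_conv_coloop _ _ eG el cl) -intrD1 cl cG.
  have qS (j : nat) : q + j.+1 = (q + 1) + j by lia.
  by rewrite (qS (rk _ _)) (qS #|_|); apply: IHn => //; lia.
have {rGD} rD : rk M (G :\ e) = rk M G.
  by apply/eqP; rewrite eqn_leq rGD rk_mono // subD1set.
have := IHn _ ltDn M q _ Dl; rewrite rD => IHD.
case: k le_k => [|k] le_k.
  by rewrite (binom_conv_delcon0 _ eG el) !gbinom0; have := IHD _ le_k; rewrite !gbinom0.
(* The contraction has rank one less and is used at index [k] instead of [k.+1], so the condition on
   [q] carries over. *)
have rC := rk_contract (G :\ e) el; rewrite setD1K // in rC.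
rewrite (binom_conv_delconS _ _ eG el) cG.
have -> : q + (#|G :\ e|).+1 = q + #|G :\ e| + 1 by lia.
rewrite intrD1 gbinomDS; have /andP[lo up] := IHD _ le_k.
have rleD : (rk M G <= #|G :\ e|)%N by rewrite -rD rk_le_card.
(* The deletion already yields the whole lower bound, and Pascal's rule leaves one binomial of the
   upper bound for the contraction. *)
suff /andP[lo' up'] : 0 <= binom_conv q%:~R (whitney R (contract M e) (G :\ e)) k
     <= gbinom ((q + #|G :\ e|%:Z)%:~R : R) k.
  by rewrite -[leLHS]addr0 !lerD.
(* An element parallel to [e] becomes a loop of the contraction; induction then does not apply, but
   the contraction's sum is 0. *)
have [/forall_inP Cl|/forall_inPn[v vD /negPn vl]] :=
    boolP [forall v in G :\ e, ~~ is_loop (contract M e) v].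
  have /andP[lo' ->] := IHn _ ltDn (contract M e) q k Cl ltac:(lia).
  by rewrite andbT (le_trans _ lo') // gbinom_ge0 //; lia.
rewrite /binom_conv big1 => [|i _]; first by rewrite lexx gbinom_ge0 //; lia.
by rewrite (whitney_loop _ _ vD vl) mulr0.
Qed.

(** * Comparison with the characteristic polynomial *)

Lemma coef_char_poly_matroid M i : (i <= rk M [set: E])%N ->
  (char_poly_matroid M)`_(rk M [set: E] - i) = (-1) ^+ i * whitney int M [set: E] i.
Proof.
move=> le_ir; rewrite /char_poly_matroid coef_sum /whitney mulr_sumr.
rewrite (eq_bigl _ _ (@subsetT E)); apply: eq_bigr => A _.
rewrite coefZ coefXn exprD !mulrA -expr2 sqrr_sign mul1r.
have := rk_mono M (subsetT A) => le_A.
by congr (_ * _%:R); congr nat_of_bool; lia.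
Qed.

Lemma whitney_eq0 (R : pzRingType) M i : (rk M [set: E] < i)%N ->
  whitney R M [set: E] i = 0.
Proof.
move=> lt_ri; apply: big1 => A sA.
by have /leq_ltn_trans/(_ lt_ri)/ltn_eqF -> := rk_mono M sA; rewrite mulr0.
Qed.

Lemma intr_whitney (R : pzRingType) M G i : (whitney int M G i)%:~R = whitney R M G i.
Proof.
rewrite /whitney rmorph_sum; apply: eq_bigr => A _.
by rewrite rmorphM rmorphXn rmorphN1 rmorph_nat.
Qed.

End Whitney.

Theorem theorem3p1 (E : finType) (M : matroid E)
  (loopless : forall v : E, ~~ is_loop M v)
  (r m : nat) (hr : r = rk M [set: E]) (hm : m = #|E|)
  (a : nat -> int)
  (hchi : char_poly_matroid M =
            \sum_(0 <= i < r.+1) ((-1) ^+ i * a i) *: 'X^(r - i))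
  (ha : forall i : nat, (r < i)%N -> a i = 0) :
  (forall (q : int) (k : nat), k%:Z <= q + r%:Z + 1 ->
     gbinom (r%:R + q%:~R : rat) k
       <= \sum_(0 <= i < k.+1) gbinom (q%:~R : rat) (k - i) * (a i)%:~R
     /\ \sum_(0 <= i < k.+1) gbinom (q%:~R : rat) (k - i) * (a i)%:~R
       <= gbinom (m%:R + q%:~R : rat) k)
  /\ (forall k : nat, (k <= r)%N ->
       (gbinom (r%:R - 1 : rat) k
          <= (-1) ^+ k * \sum_(0 <= i < k.+1) (-1) ^+ i * (a i)%:~R
        /\ (-1) ^+ k * \sum_(0 <= i < k.+1) (-1) ^+ i * (a i)%:~R
          <= gbinom (m%:R - 1 : rat) k)
       /\ 0 <= (-1) ^+ k *
               \sum_(0 <= i < k.+1)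
                  gbinom (r%:R - i%:R : rat) (k - i) * (-1) ^+ i * (a i)%:~R).
Proof.
(* For i <= r, compare coefficients of t^(r-i); the exponents r - j with j <= r are distinct. Beyond
   r both sides are 0. *)
have aW i : a i = whitney int M [set: E] i.
  have [lt_ri|le_ir] := ltnP r i; first by rewrite ha // whitney_eq0 -?hr.
  have := coef_char_poly_matroid (M := M) (i := i); rewrite -hr => /(_ le_ir).
  rewrite hchi coef_sum big_mkord (bigD1 (inord i)) //= inordK // big1 => [|j ji].
    by rewrite coefZ coefXn eqxx mulr1 addr0 => /(congr1 ( *%R ((-1) ^+ i)));
      rewrite !signrMK.
  rewrite coefZ coefXn; case: eqP => [eq_ij|]; rewrite ?mulr0 //.
  have := ltn_ord j => lt_jr; case/eqP: ji.
  by apply/val_inj; rewrite /= inordK //; lia.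
have bounds (q : int) (k : nat) : k%:Z <= q + r%:Z + 1 ->
    gbinom (r%:R + q%:~R : rat) k
      <= \sum_(0 <= i < k.+1) gbinom (q%:~R : rat) (k - i) * (a i)%:~R
    /\ \sum_(0 <= i < k.+1) gbinom (q%:~R : rat) (k - i) * (a i)%:~R
      <= gbinom (m%:R + q%:~R : rat) k.
  have := @whitney_bounds E rat M [set: E] q k (fun v _ => loopless v).
  rewrite -hr cardsT -hm => W /W; rewrite !(addrC q) !intrD => /andP[lo up].
  suff -> : \sum_(0 <= i < k.+1) gbinom (q%:~R : rat) (k - i) * (a i)%:~R =
    binom_conv q%:~R (whitney rat M [set: E]) k by [].
  by rewrite big_mkord; apply: eq_bigr => i _; rewrite aW intr_whitney.
have signB (k i : nat) : (i < k.+1)%N -> (-1) ^+ k = (-1) ^+ (k - i) * (-1) ^+ i :> rat.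
  by move=> le_ik; rewrite -exprD subnK.
split=> // k le_kr; split.
  (* At q = -1 the binomial of lower index k - i is (-1)^(k-i). *)
  have := bounds (-1) k; rewrite rmorphN1.
  suff -> : \sum_(0 <= i < k.+1) gbinom (- 1 : rat) (k - i) * (a i)%:~R =
    (-1) ^+ k * \sum_(0 <= i < k.+1) (-1) ^+ i * (a i)%:~R by apply; lia.
  rewrite mulr_sumr; apply: eq_big_nat => i /andP[_ /signB ->].
  rewrite gbinomN addrAC subrr add0r.
  by rewrite gbinomnn mulr1 -mulrA signrMK.
(* With q = k - r - 1 the condition is an equality, and the lower bound has upper index r + q = k -
   1, just enough for [gbinom_ge0]. *)
have le_k : k%:Z <= k%:Z - r%:Z - 1 + r%:Z + 1 by lia.
have [lo _] := bounds _ _ le_k.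
suff <- : \sum_(0 <= i < k.+1) gbinom ((k%:Z - r%:Z - 1)%:~R : rat) (k - i) * (a i)%:~R =
  (-1) ^+ k * \sum_(0 <= i < k.+1)
                 gbinom (r%:R - i%:R : rat) (k - i) * (-1) ^+ i * (a i)%:~R.
  by apply: le_trans lo; rewrite -[r%:R]/(r%:Z%:~R) -intrD gbinom_ge0 //; lia.
rewrite mulr_sumr; apply: eq_big_nat => i /andP[_ le_ik].
(* Reflection sends the upper index q to -q + (k - i) - 1 = r - i. *)
have -> : (k%:Z - r%:Z - 1)%:~R = - (r%:R - k%:R + 1) :> rat.
  by rewrite !intrB; ring.
rewrite gbinomN natrB // (signB _ _ le_ik).
have -> : r%:R - k%:R + 1 + (k%:R - i%:R) - 1 = r%:R - i%:R :> rat by ring.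
by rewrite [gbinom _ _ * _]mulrC -!mulrA signrMK.
Qed.
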